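(* Let $(V,g)$ be a global in time spacetime of dimension $n+1$, solution of the Einstein field equations, where in coordinates $(x^\alpha)=(x^0,x^1,\dots,x^n)$ $$g=-\frac{|\overline g|}{\Omega^2}(dx^0)^2+\overline g_{ij}\,dx^i dx^j,\qquad \overline g=(\overline g_{ij}),$$ $|\overline g|$ is the determinant of $\overline g$, and $\Omega=\Omega(x^i)$ is an arbitrary given positive scalar density with $\Omega\to 0$ as $r=|(x^i)|\to+\infty$. Let $h=\Omega^2 g$, let $G$ be the inverse of $h$, and let $\widehat\nabla$ be the Levi-Civita connection of $h$. Specify the gauge $(\omega^\alpha)$ given by $\omega^0=e^{-\Omega x^0}$, $\omega^1=\Omega$, $\omega^a=\arctan(\Omega x^a)$ for $a=2,\dots,n$. Put $m=G\left(\frac{d\omega^0}{\Omega\omega^0},\frac{d\omega^0}{\Omega\omega^0}\right)$. Suppose that $\mathcal H=\{m=0\}$ is nonempty and is a smooth hypersurface, that $$h\left(\widehat\nabla_{\frac{\partial}{\partial\omega^0}}\frac{\widehat\nabla\omega^0}{\Omega\omega^0},\frac{\widehat\nabla\omega^0}{\Omega\omega^0}\right)<0,\qquad h\left(\widehat\nabla_{\widehat h^{0i}\frac{\partial}{\partial\omega^i}}\frac{\widehat\nabla\omega^0}{\Omega\omega^0},\frac{\widehat\nabla\omega^0}{\Omega\omega^0}\right)>0,$$ and that, at every point of the surfaces $H_{\mu\nu}$ ($\mu,\nu>0$), the objects $\mathbf U,\mathbf V,\mathbf b^{\pm}$ defined in the context satisfy $$\operatorname{tr}\mathbf V<0,\qquad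 \operatorname{tr}\mathbf U\in\left]-\frac{\operatorname{tr}\mathbf V}{\mathbf b^-},\,-\frac{\operatorname{tr}\mathbf V}{\mathbf b^+}\right[.$$ Then the spacetime $(V,g)$ undergoes formation of trapped surfaces: the codimension $2$ spacelike surfaces $H_{\mu\nu}$ satisfy $\operatorname{tr}\chi<0$ and $\operatorname{tr}\underline\chi<0$.
   Context: Indices: $\alpha,\beta=0,\dots,n$; $i,j=1,\dots,n$; $a,b=2,\dots,n$ in coordinate expressions. The Einstein equations are $Ric(g)-\frac12 R_{scal}\,g=8\pi T$. Standing assumptions: $\Omega$ is positive, bounded, independent of $x^0$, and $\partial\Omega/\partial x^1$ does not vanish; $(\omega^\alpha)$ is used as a coordinate system and takes values in $\widehat V=]0,1]\times]0,\Omega_{\max}]\times(]-\frac\pi2,\frac\pi2[)^{n-1}$. Functions and tensors are regarded as living on $(\widehat V,h)$; $\widehat h^{\alpha\beta}$ denotes the components of the inverse of $h$ in the coordinates $(\omega^\alpha)$; $\widehat\nabla f$ denotes the gradient of a function $f$ with respect to $h$. The inequalities without specified location are understood at all points of $\widehat V$. Surfaces $H_{\mu\nu}$: for $\mu>0,\nu>0$, $$H_{\mu\nu}=\{(\omega^\alpha)\in\widehat V:\ \omega^0+m=\mu,\ m=\nu\}\subset\{m>0\}.$$ It is assumed that $\widehat\nabla m$ is timelike and future pointing on $\{m\ge 0\}$ and that the surfaces $H_{\mu\nu}$ are compact. Null normals: at each point of $H_{\mu\nu}$, the normal plane (orthogonal complement of the tangent space) is spanned by $\widehat\nabla\omega^0,\widehat\nabla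 m$, and the two future null normals are $$l^+=\mathbf a(\mathbf b^+\widehat\nabla\omega^0+\widehat\nabla m),\qquad l^-=\mathbf a(\mathbf b^-\widehat\nabla\omega^0+\widehat\nabla m),$$ $$\mathbf b^{\pm}=\frac{-h(\widehat\nabla\omega^0,\widehat\nabla m)\pm\sqrt{(h(\widehat\nabla\omega^0,\widehat\nabla m))^2-h(\widehat\nabla\omega^0,\widehat\nabla\omega^0)\,h(\widehat\nabla m,\widehat\nabla m)}}{h(\widehat\nabla\omega^0,\widehat\nabla\omega^0)},$$ where the scaling $\mathbf a>0$ is chosen such that $h(l^+,l^-)=-2$. For a reference frame $(e_a)$ tangent to $H_{\mu\nu}$: $\chi_{ab}=h(\widehat\nabla_{e_a}l^+,e_b)$, $\underline\chi_{ab}=h(\widehat\nabla_{e_a}l^-,e_b)$ (the null second fundamental forms), $\mathbf U_{ab}=h(\widehat\nabla_{e_a}\widehat\nabla\omega^0,e_b)$, $\mathbf V_{ab}=h(\widehat\nabla_{e_a}\widehat\nabla m,e_b)$. The traces $\operatorname{tr}$ are taken with the metric induced by $h$ on $H_{\mu\nu}$; $\operatorname{tr}\chi$ and $\operatorname{tr}\underline\chi$ are the null mean curvatures. *)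

(* Defs.v *)
From HB Require Import structures.
From mathcomp Require Import all_boot all_order all_algebra.
From mathcomp Require Import all_classical all_reals all_analysis.

Set Implicit Arguments.
Unset Strict Implicit.
Unset Printing Implicit Defensive.

Import Order.TTheory GRing.Theory Num.Theory.
Import numFieldNormedType.Exports.

Local Open Scope classical_set_scope.
Local Open Scope ring_scope.

(* Points, tangent vectors and covectors in a chart of dimension d are all row
   vectors 'rV[R]_d; a symmetric (0,2) tensor field is a matrix-valued
   function, and a bilinear form M acts by u M v^T. *)

Section Calculus.
Context {R : realType} {d : nat}.
Implicit Types (f : 'rV[R]_d -> R) (x u v : 'rV[R]_d) (M : 'M[R]_d).

Definition coord_vec (a : 'I_d) : 'rV[R]_d := delta_mx ord0 a.

Definition partial (a : 'I_d) f : 'rV[R]_d -> R := fun x => 'D_(coord_vec a) f x.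

Definition dform f x : 'rV[R]_d := \row_a partial a f x.

(* C^k and C^oo on a set A, meant for open A. *)
Fixpoint Ck (k : nat) (A : set 'rV[R]_d) f : Prop :=
  if k is k'.+1 then
    (forall x, A x -> differentiable f x) /\
    (forall a, Ck k' A (partial a f))
  else forall x, A x -> {for x, continuous f}.

Definition smooth (A : set 'rV[R]_d) f : Prop := forall k, Ck k A f.

Definition inner M u v : R := (u *m M *m v^T) ord0 ord0.

(* Column j holds the differential at x of the j-th defining function. *)
Definition differentials k (F : 'I_k -> 'rV[R]_d -> R) x : 'M[R]_(d, k) :=
  \matrix_(a, j) partial a (F j) x.

(* Sigma is a smooth submanifold of codimension k of W: near each of its points
   it is the common zero set in W of k smooth functions with independent
   differentials.  W may have a boundary, hence the neighbourhood O in the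
   ambient chart. *)
Definition smooth_submanifold (k : nat) (W Sigma : set 'rV[R]_d) : Prop :=
  Sigma `<=` W /\
  forall p, Sigma p ->
    exists (O : set 'rV[R]_d) (F : 'I_k -> 'rV[R]_d -> R),
      [/\ open O, O p, forall j, smooth O (F j),
          forall x, O x -> \rank (differentials F x) = k
        & forall x, O x -> (Sigma x <-> W x /\ forall j, F j x = 0)].

End Calculus.

Section Geometry.
Context {R : realType} {d : nat}.
Context (g : 'rV[R]_d -> 'M[R]_d).
Implicit Types (f : 'rV[R]_d -> R) (x u v : 'rV[R]_d).
Implicit Types (X Y : 'rV[R]_d -> 'rV[R]_d).

Definition grad f : 'rV[R]_d -> 'rV[R]_d :=
  fun x => dform f x *m invmx (g x).

(* Gamma^c_{ab} *)
Definition christoffel (c a b : 'I_d) : 'rV[R]_d -> R := fun x =>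
  2^-1 * \sum_e invmx (g x) c e *
    (partial a (fun y => g y e b) x + partial b (fun y => g y a e) x
     - partial e (fun y => g y a b) x).

(* The Levi-Civita derivative at x of the field Y in the direction of the
   vector v. *)
Definition nabla v Y x : 'rV[R]_d :=
  \row_c \sum_a v ord0 a *
    (partial a (fun y => Y y ord0 c) x
     + \sum_b christoffel c a b x * Y x ord0 b).

Definition ricci x : 'M[R]_d :=
  \matrix_(a, b) \sum_c
    (partial c (christoffel c a b) x - partial b (christoffel c a c) x
     + \sum_e (christoffel c c e x * christoffel e a b x
               - christoffel c b e x * christoffel e a c x)).

Definition scalar_curvature x : R := \tr (invmx (g x) *m ricci x).

Definition einstein_equations (T : 'rV[R]_d -> 'M[R]_d)
    (V : set 'rV[R]_d) : Prop :=
  forall x, V x ->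
    ricci x - (2^-1 * scalar_curvature x) *: g x = (8 * pi) *: T x.

(* The rows of E are the vectors e_a; the entries are g(nabla_{e_a} L, e_b). *)
Definition second_form k (E : 'M[R]_(k, d)) L x : 'M[R]_k :=
  \matrix_(a, b) inner (g x) (nabla (row a E) L x) (row b E).

(* Trace, with respect to the metric induced by g on the span of the rows of E,
   of the bilinear form with components B in the frame E. *)
Definition frame_trace k (E : 'M[R]_(k, d)) x (B : 'M[R]_k) : R :=
  \tr (invmx (E *m g x *m E^T) *m B).

End Geometry.

Section Spacetime.
Context {R : realType} {n : nat}.
Local Notation pt := 'rV[R]_n.+1.

Definition spatial (x : pt) : 'rV[R]_n := \row_i x ord0 (lift ord0 i).

Definition eucl_radius (s : 'rV[R]_n) : R := Num.sqrt (\sum_i s ord0 i ^+ 2).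

(* The coordinate domain I x D of (x^0, x^i). *)
Definition spacetime (I : set R) (D : set 'rV[R]_n) : set pt :=
  [set x : pt | I (x ord0 ord0) /\ D (spatial x)].

Definition posdef_sym (M : 'M[R]_n) : Prop :=
  M^T = M /\ forall v : 'rV[R]_n, v != 0 -> 0 < inner M v v.

Definition metric_g (Omega : 'rV[R]_n -> R) (gbar : pt -> 'M[R]_n)
    (x : pt) : 'M[R]_n.+1 :=
  block_mx (- (\det (gbar x) / Omega (spatial x) ^+ 2))%:M 0
           0 (gbar x) : 'M[R]_(1 + n).

Definition metric_h (Omega : 'rV[R]_n -> R) (gbar : pt -> 'M[R]_n)
    (x : pt) : 'M[R]_n.+1 :=
  Omega (spatial x) ^+ 2 *: metric_g Omega gbar x.

Definition gauge (Omega : 'rV[R]_n -> R) (x : pt) : pt :=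
  \row_(a < n.+1)
    (if a == 0%N :> nat then expR (- (Omega (spatial x) * x ord0 ord0))
     else if a == 1%N :> nat then Omega (spatial x)
     else atan (Omega (spatial x) * x ord0 a)).

(* psi is a smooth inverse of phi from the open set phi @` U onto U. *)
Definition coordinate_system (U : set pt) (phi psi : pt -> pt) : Prop :=
  [/\ open U, open (phi @` U),
      forall a, smooth U (fun x => phi x ord0 a),
      forall a, smooth (phi @` U) (fun y => psi y ord0 a)
    & forall x, U x -> psi (phi x) = x].

(* Components of a metric in the coordinates y = phi x, with psi = phi^-1;
   row a of the Jacobian is the vector d/dy^a in the coordinates x. *)
Definition pullback (psi : pt -> pt) (h : pt -> 'M[R]_n.+1)
    (y : pt) : 'M[R]_n.+1 :=
  'J psi y *m h (psi y) *m ('J psi y)^T.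

(* ]0,1] x ]0,M] x ]-pi/2,pi/2[^(n-1) *)
Definition gauge_box (M : R) : set pt :=
  [set y : pt | [/\ 0 < y ord0 ord0 <= 1, 0 < y ord0 (inord 1) <= M
    & forall a : 'I_n.+1, (1 < a)%N -> - (pi / 2) < y ord0 a < pi / 2]].

(* From here on the coordinates are (omega^alpha) and h is the matrix of the
   conformal metric in them; the functions omega^0 and Omega are the
   coordinate functions y^0 and y^1. *)
Context (h : pt -> 'M[R]_n.+1).

Definition omega0 (y : pt) : R := y ord0 ord0.

Definition scale (y : pt) : R := (y ord0 (inord 1) * omega0 y)^-1.

Definition m_fun (y : pt) : R :=
  inner (invmx (h y)) (scale y *: dform omega0 y) (scale y *: dform omega0 y).

Definition scaled_grad (y : pt) : pt := scale y *: grad h omega0 y.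

Definition shift_vector (y : pt) : pt :=
  \sum_(i < n) invmx (h y) ord0 (lift ord0 i) *: coord_vec (lift ord0 i).

Definition timelike (y v : pt) : Prop := inner (h y) v v < 0.

Definition time_orientation (W : set pt) (tau : pt -> pt) : Prop :=
  {within W, continuous tau} /\ forall y, W y -> timelike y (tau y).

(* For a causal vector v: v is in the same half-cone as tau. *)
Definition future_pointing (tau : pt -> pt) (y v : pt) : Prop :=
  inner (h y) v (tau y) < 0.

Definition surface_H (W : set pt) (mu nu : R) : set pt :=
  [set y | [/\ W y, omega0 y + m_fun y = mu & m_fun y = nu]].

Definition surface_eqs (mu nu : R) (j : 'I_2) (y : pt) : R :=
  if j == ord0 then omega0 y + m_fun y - mu else m_fun y - nu.

(* The tangent space of H_{mu nu} at y is the row space of this matrix. *)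
Definition tangent_H (mu nu : R) (y : pt) : 'M[R]_n.+1 :=
  kermx (differentials (surface_eqs mu nu) y).

Definition tangent_frame (mu nu : R) (y : pt) (E : 'M[R]_(n.-1, n.+1)) : Prop :=
  row_free E /\ (E :=: tangent_H mu nu y)%MS.

Definition b_disc (y : pt) : R :=
  inner (h y) (grad h omega0 y) (grad h m_fun y) ^+ 2
  - inner (h y) (grad h omega0 y) (grad h omega0 y)
    * inner (h y) (grad h m_fun y) (grad h m_fun y).

Definition b_plus (y : pt) : R :=
  (- inner (h y) (grad h omega0 y) (grad h m_fun y) + Num.sqrt (b_disc y))
  / inner (h y) (grad h omega0 y) (grad h omega0 y).

Definition b_minus (y : pt) : R :=
  (- inner (h y) (grad h omega0 y) (grad h m_fun y) - Num.sqrt (b_disc y))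
  / inner (h y) (grad h omega0 y) (grad h omega0 y).

Definition l_plus (a : pt -> R) (y : pt) : pt :=
  a y *: (b_plus y *: grad h omega0 y + grad h m_fun y).

Definition l_minus (a : pt -> R) (y : pt) : pt :=
  a y *: (b_minus y *: grad h omega0 y + grad h m_fun y).

(* Imposed near y, because the null normals get differentiated at y. *)
Definition null_scaling (a : pt -> R) (y : pt) : Prop :=
  \forall z \near y, 0 < a z /\ inner (h z) (l_plus a z) (l_minus a z) = -2.

End Spacetime.

(* Main.v *)
Require Import Defs.
From HB Require Import structures.
From mathcomp Require Import all_boot all_order all_algebra.
From mathcomp Require Import all_classical all_reals all_analysis.
From mathcomp Require Import ring lra.

Set Implicit Arguments.
Unset Strict Implicit.
Unset Printing Implicit Defensive.

Import Order.TTheory GRing.Theory Num.Theory.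
Import numFieldNormedType.Exports.

Local Open Scope classical_set_scope.
Local Open Scope ring_scope.

(** On [{m > 0}] the gradient of [omega^0] is spacelike (because
    [m = |X|^2] with [X] a multiple of it) while that of [m] is timelike.  Hence
    the two are independent, so that [H_{mu nu}] is a submanifold, its tangent
    vectors are spacelike since [h] is Lorentzian, and [b^- < 0 < b^+].
    Differentiating [l^{+-} = a (b^{+-} grad omega^0 + grad m)] along tangent
    vectors, the derivatives of [a] and [b^{+-}] only produce normal components,
    so [tr chi = a (b^+ tr U + tr V)], and likewise for [l^-]; the interval
    prescribed for [tr U] says exactly that both are negative.

    Some [H_{mu nu}] is nonempty: by metric compatibility
    [d m / d omega^0 = 2 h (nabla_{d/d omega^0} X, X) < 0], and letting [x^0]
    grow at fixed [x^i] decreases [omega^0] at fixed [omega^i], so [m] becomes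
    positive on the future side of a point of [{m = 0}]. *)

(** * Partial derivatives and functions of class C^k *)

(** The difference [g - f] vanishes near [x], so it is [o(id)] with zero linear part; [diff_unique]
    makes its differential zero, and [g = f + (g - f)]. *)
Lemma near_eq_differentiable (R : numFieldType) (V W : normedModType R)
    (f g : V -> W) (x : V) :
  {near x, f =1 g} -> differentiable f x -> differentiable g x.
Proof.
move=> fg df.
suff dgf : differentiable (g \- f) x.
  have -> : g = f + (g \- f) by apply/funext => y /=; rewrite /= addrC subrK.
  exact: differentiableD.
have gf0 : (g \- f) \o shift x = cst ((g \- f) x) + (\0 : V -> W) +o_ 0 id.
  apply/eqaddoP => e e0; near=> y.
  rewrite !fctE /= -(nbhs_singleton fg) subrr add0r.
  have -> : g (y + x) = f (y + x).
    symmetry; near: y; move: (fg); rewrite (near_shift 0) => fg0.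
    by apply: filterS fg0 => z; rewrite /= subr0.
  by rewrite !subrr normr0 mulr_ge0// ltW.
have /(_ _) d0 := @diff_unique _ V W (g \- f) \0%R x _ gf0.
apply/diff_locallyP; rewrite d0//; last exact: cst_continuous.
by split => //; exact: cst_continuous.
Unshelve. all: by end_near. Qed.

Section PartialDerivatives.
Context {R : realType} {d : nat}.
Implicit Types (f g : 'rV[R]_d -> R) (A : set 'rV[R]_d) (x : 'rV[R]_d).

Lemma partial_near c f g x :
  {near x, f =1 g} -> partial c f x = partial c g x.
Proof. by move=> fg; apply: near_eq_derive. Qed.

Lemma partial_eq_on A c f g x : open A -> (forall y, A y -> f y = g y) -> A x ->
  partial c f x = partial c g x.
Proof.
move=> oA fg Ax; apply: partial_near.
by apply: filterS (open_nbhs_nbhs (conj oA Ax)) => y; exact: fg.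
Qed.

Lemma partial_cst c (r : R) x : partial c (fun=> r) x = 0 :> R.
Proof. exact: derive_cst. Qed.

Lemma partialD c f g x : differentiable f x -> differentiable g x ->
  partial c (fun y => f y + g y) x = partial c f x + partial c g x.
Proof. by move=> df dg; apply: deriveD; exact: diff_derivable. Qed.

Lemma partialM c f g x : differentiable f x -> differentiable g x ->
  partial c (fun y => f y * g y) x = partial c f x * g x + f x * partial c g x.
Proof.
move=> df dg; rewrite /partial deriveM; try exact: diff_derivable.
by rewrite addrC /GRing.scale/= mulrC.
Qed.

Lemma differentiable_sumr (J : Type) (r : seq J) (P : pred J)
    (F : J -> 'rV[R]_d -> R) x :
  (forall j, P j -> differentiable (F j) x) ->
  differentiable (fun y => \sum_(j <- r | P j) F j y) x.
Proof.
move=> dF; elim: r => [|j r IH].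
  by rewrite (_ : (fun _ => _) = cst 0)//; apply/funext => y; rewrite big_nil.
have [Pj|nPj] := boolP (P j).
  rewrite (_ : (fun _ => _) = F j \+ fun y => \sum_(j <- r | P j) F j y).
    by apply: differentiableD => //; exact: dF.
  by apply/funext => y; rewrite big_cons Pj.
rewrite (_ : (fun _ => _) = fun y => \sum_(j <- r | P j) F j y)//.
by apply/funext => y; rewrite big_cons (negbTE nPj).
Qed.

Lemma partial_sum c (J : Type) (r : seq J) (P : pred J)
    (F : J -> 'rV[R]_d -> R) x :
  (forall j, P j -> differentiable (F j) x) ->
  partial c (fun y => \sum_(j <- r | P j) F j y) x =
  \sum_(j <- r | P j) partial c (F j) x.
Proof.
move=> dF; elim: r => [|j r IH].
  rewrite big_nil (_ : (fun _ => _) = cst 0) ?partial_cst//.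
  by apply/funext => y; rewrite big_nil.
rewrite big_cons -IH; have [Pj|nPj] := boolP (P j).
  rewrite -partialD; [|exact: dF|exact: differentiable_sumr].
  by congr partial; apply/funext => y; rewrite big_cons Pj.
by congr partial; apply/funext => y; rewrite big_cons (negbTE nPj).
Qed.

Lemma partialV c f x : differentiable f x -> f x != 0 ->
  partial c (fun y => (f y)^-1) x = - ((f x)^-1 * (f x)^-1 * partial c f x).
Proof.
move=> df fx0; rewrite /partial deriveV//; last exact: diff_derivable.
by rewrite /GRing.scale/= -exprVn expr2 mulNr.
Qed.

Lemma partial_coord c i x :
  partial c (fun y : 'rV[R]_d => y ord0 i) x = (c == i)%:R :> R.
Proof.
have := @derive_mx R _ 1 d id x (coord_vec c) (@derivable_id _ _ _ _).
rewrite derive_id => /matrixP/(_ ord0 i); rewrite !mxE /partial /= => <-.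
by rewrite eq_sym.
Qed.

(** [phi] is the finite sum of its scalar components times constant basis vectors. *)
Lemma differentiable_coordinates (e : nat) (phi : 'rV[R]_d -> 'rV[R]_e) x :
  (forall i, differentiable (fun y => phi y ord0 i : R) x) ->
  differentiable phi x.
Proof.
move=> dphi.
have -> : phi = \sum_(i < e) (fun y => phi y ord0 i *: (delta_mx ord0 i : 'rV[R]_e)).
  by apply/funext => y; rewrite fct_sumE -row_sum_delta.
by apply: differentiable_sum => i; exact: differentiableZl.
Qed.

Lemma derive_partial v f x : differentiable f x ->
  'D_v f x = \sum_c v ord0 c * partial c f x.
Proof.
move=> df; rewrite deriveE// {1}(row_sum_delta v) linear_sum.
by apply: eq_bigr => c _; rewrite linearZ/= /partial deriveE.
Qed.

End PartialDerivatives.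

Lemma partial_comp (R : realType) (d e : nat) (phi : 'rV[R]_d -> 'rV[R]_e)
    (f : 'rV[R]_e -> R) c x :
  (forall i, differentiable (fun y => phi y ord0 i : R) x) ->
  differentiable f (phi x) ->
  partial c (fun y => f (phi y)) x =
  \sum_i partial c (fun y => phi y ord0 i) x * partial i f (phi x).
Proof.
move=> dphi df.
have dp : differentiable phi x by exact: differentiable_coordinates.
rewrite /partial deriveE; last exact: differentiable_comp.
rewrite diff_comp//= -deriveE// derive_partial//; apply: eq_bigr => i _.
congr (_ * _); rewrite -deriveE// derive_mx ?mxE//; exact: diff_derivable.
Qed.

(** * Closure properties of the classes C^k *)

Section SmoothFunctions.
Context {R : realType} {d : nat}.
Implicit Types (k : nat) (f g : 'rV[R]_d -> R) (A B : set 'rV[R]_d) (x : 'rV[R]_d).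

(** A derivative at a point only sees a neighbourhood, and [A] is open. The closure properties below
    rely on this: their formulas for partial derivatives are established on [A] only, not as
    equalities of functions. *)
Lemma Ck_eq_on k A f g : open A -> (forall y, A y -> f y = g y) ->
  Ck k A f -> Ck k A g.
Proof.
move=> oA; elim: k f g => [|k IH] f g fg /=.
  move=> cf x Ax; have := cf _ Ax.
  have nfg : {near x, f =1 g}.
    by apply: filterS (open_nbhs_nbhs (conj oA Ax)) => y; exact: fg.
  rewrite /prop_for /continuous_at -(fg _ Ax) => fc.
  exact: cvg_trans (near_eq_cvg nfg) fc.
move=> [df pf]; split=> [x Ax|c].
  apply: near_eq_differentiable (df _ Ax).
  by apply: filterS (open_nbhs_nbhs (conj oA Ax)) => y; exact: fg.
apply: IH (pf c) => y Ay; exact: (partial_eq_on _ oA fg).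
Qed.

Lemma Ck_sub k A B f : A `<=` B -> Ck k B f -> Ck k A f.
Proof.
move=> AB; elim: k f => [|k IH] f /=; first by move=> cf x /AB; exact: cf.
by move=> [df pf]; split=> [x /AB|c]; [exact: df | exact: IH].
Qed.

Lemma CkW k A f : Ck k.+1 A f -> Ck k A f.
Proof.
elim: k f => [|k IH] f; last by move=> [df pf]; split=> // c; apply: IH; exact: pf.
by move=> [df _] x Ax; apply: differentiable_continuous; exact: df.
Qed.

Lemma Ck_cst k A (r : R) : Ck k A (fun=> r).
Proof.
elim: k r => [|k IH] r /=; first by move=> x _; exact: cst_continuous.
split=> [x _|c]; first exact: differentiable_cst.
have -> : partial c (fun=> r) = fun=> 0 :> R by apply/funext => x; exact: partial_cst.
exact: IH.
Qed.

Lemma Ck_coord k A i : Ck k A (fun x => x ord0 i).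
Proof.
case: k => [|k] /=; first by move=> x _; exact: coord_continuous.
split=> [x _|c]; first exact: differentiable_coord.
have -> : partial c (fun y : 'rV[R]_d => y ord0 i) = fun=> (c == i)%:R.
  by apply/funext => x; exact: partial_coord.
exact: Ck_cst.
Qed.

Lemma CkD k A f g : open A -> Ck k A f -> Ck k A g -> Ck k A (fun x => f x + g x).
Proof.
move=> oA; elim: k f g => [|k IH] f g /=.
  by move=> cf cg x Ax; apply: continuousD; [exact: cf | exact: cg].
move=> [df pf] [dg pg]; split=> [x Ax|c].
  by apply: differentiableD; [exact: df | exact: dg].
apply: (Ck_eq_on oA _ (IH _ _ (pf c) (pg c))) => x Ax.
by rewrite partialD//; [exact: df | exact: dg].
Qed.

Lemma CkM k A f g : open A -> Ck k A f -> Ck k A g -> Ck k A (fun x => f x * g x).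
Proof.
move=> oA; elim: k f g => [|k IH] f g.
  by move=> cf cg x Ax; apply: continuousM; [exact: cf | exact: cg].
move=> Cf Cg; have [df pf] := Cf; have [dg pg] := Cg; split=> [x Ax|c].
  by apply: differentiableM; [exact: df | exact: dg].
(* The Leibniz terms also contain [f] and [g] themselves, which [CkW] lowers to class [k]. *)
apply: (Ck_eq_on oA _ (CkD oA (IH _ _ (pf c) (CkW Cg)) (IH _ _ (CkW Cf) (pg c)))).
by move=> x Ax; rewrite partialM//; [exact: df | exact: dg].
Qed.

Lemma CkN k A f : open A -> Ck k A f -> Ck k A (fun x => - f x).
Proof.
move=> oA Cf; apply: Ck_eq_on oA _ (CkM oA (Ck_cst k A (-1)) Cf) => x _.
by rewrite mulN1r.
Qed.

Lemma CkV k A f : open A -> (forall x, A x -> f x != 0) -> Ck k A f ->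
  Ck k A (fun x => (f x)^-1).
Proof.
move=> oA f0; elim: k => [|k IH].
  by move=> cf x Ax; apply: continuousV; [exact: f0 | exact: cf].
move=> Cf; have [df pf] := Cf; split=> [x Ax|c].
  by apply: differentiableV; [exact: df | exact: f0].
(* The derivative of [1 / f] contains [1 / f] again, which is of class [k] by induction. *)
have CV := IH (CkW Cf).
apply: (Ck_eq_on oA _ (CkN oA (CkM oA (CkM oA CV CV) (pf c)))) => x Ax.
by rewrite partialV//; [exact: df | exact: f0].
Qed.

Lemma Ck_sum k A (J : Type) (r : seq J) (P : pred J) (F : J -> 'rV[R]_d -> R) :
  open A -> (forall j, P j -> Ck k A (F j)) ->
  Ck k A (fun x => \sum_(j <- r | P j) F j x).
Proof.
move=> oA CF; elim: r => [|j r IH].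
  by apply: Ck_eq_on oA _ (Ck_cst k A 0) => x _; rewrite big_nil.
have [Pj|nPj] := boolP (P j).
  apply: Ck_eq_on oA _ (CkD oA (CF j Pj) IH) => x _; by rewrite big_cons Pj.
by apply: Ck_eq_on oA _ IH => x _; rewrite big_cons (negbTE nPj).
Qed.

Lemma Ck_prod k A (J : Type) (r : seq J) (P : pred J) (F : J -> 'rV[R]_d -> R) :
  open A -> (forall j, P j -> Ck k A (F j)) ->
  Ck k A (fun x => \prod_(j <- r | P j) F j x).
Proof.
move=> oA CF; elim: r => [|j r IH].
  by apply: Ck_eq_on oA _ (Ck_cst k A 1) => x _; rewrite big_nil.
have [Pj|nPj] := boolP (P j).
  apply: Ck_eq_on oA _ (CkM oA (CF j Pj) IH) => x _; by rewrite big_cons Pj.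
by apply: Ck_eq_on oA _ IH => x _; rewrite big_cons (negbTE nPj).
Qed.

Lemma Ck_mulmx k A (m n p : nat) (M : 'rV[R]_d -> 'M[R]_(m, n))
    (N : 'rV[R]_d -> 'M[R]_(n, p)) i j : open A ->
  (forall i j, Ck k A (fun x => M x i j)) ->
  (forall i j, Ck k A (fun x => N x i j)) ->
  Ck k A (fun x => (M x *m N x) i j).
Proof.
move=> oA CM CN.
apply: (@Ck_eq_on _ _ (fun x => \sum_l M x i l * N x l j)) => // [x _|].
  by rewrite mxE.
by apply: Ck_sum => // l _; exact: CkM.
Qed.

Lemma Ck_det k A n (M : 'rV[R]_d -> 'M[R]_n) : open A ->
  (forall i j, Ck k A (fun x => M x i j)) -> Ck k A (fun x => \det (M x)).
Proof.
move=> oA CM; rewrite /determinant; apply: Ck_sum => // s _.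
by apply: CkM => //; [exact: Ck_cst | exact: Ck_prod].
Qed.

(** Cramer's rule: the entries are cofactors divided by the determinant, which does not vanish on
    [A]. *)
Lemma Ck_invmx k A n (M : 'rV[R]_d -> 'M[R]_n) i j : open A ->
  (forall x, A x -> M x \in unitmx) ->
  (forall i j, Ck k A (fun x => M x i j)) ->
  Ck k A (fun x => invmx (M x) i j).
Proof.
move=> oA uM CM.
apply: (@Ck_eq_on _ _ (fun x => (\det (M x))^-1 * cofactor (M x) j i)) => //.
  by move=> x Ax; rewrite /invmx (uM _ Ax) !mxE.
apply: CkM => //.
  by apply: CkV => //; [move=> x /uM; rewrite unitmxE unitfE | exact: Ck_det].
apply: CkM => //; first exact: Ck_cst.
apply: Ck_det => // i' j'.
by under [X in Ck _ _ X]funext do rewrite !mxE.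
Qed.

End SmoothFunctions.

(** Induction on [k] with the chain rule. One more derivative is asked of [phi] because even its
    continuity is obtained from the differentiability of its components; for smooth maps the loss is
    immaterial. *)
Lemma Ck_comp (R : realType) (d e k : nat) (A : set 'rV[R]_d) (B : set 'rV[R]_e)
    (phi : 'rV[R]_d -> 'rV[R]_e) (f : 'rV[R]_e -> R) :
  open A -> (forall x, A x -> B (phi x)) ->
  (forall i, Ck k.+1 A (fun x => phi x ord0 i)) -> Ck k B f ->
  Ck k A (fun x => f (phi x)).
Proof.
move=> oA AB Cphi.
have dphi x : A x -> differentiable phi x.
  by move=> Ax; apply: differentiable_coordinates => i; have [+ _] := Cphi i; apply.
elim: k f Cphi => [|k IH] f Cphi.
  move=> cf x Ax; apply: continuous_comp; last exact: cf (AB _ Ax).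
  exact/differentiable_continuous/dphi.
move=> [df pf]; split=> [x Ax|c].
  by apply: differentiable_comp; [exact: dphi | exact: df (AB _ Ax)].
apply: (@Ck_eq_on _ _ _ _ (fun x => \sum_i partial c (fun y => phi y ord0 i) x
   * partial i f (phi x))) => // [x Ax|].
  rewrite partial_comp//; last exact: df (AB _ Ax).
  by move=> i; have [+ _] := Cphi i; apply.
apply: Ck_sum => // i _; apply: CkM => //.
  by apply: CkW; have [_] := Cphi i; apply.
by apply: IH (pf i) => j; exact: CkW.
Qed.

(** * Metrics and the Levi-Civita derivative *)

Section InnerProduct.
Context {R : realType} {d : nat}.
Implicit Types (M : 'M[R]_d) (u v w : 'rV[R]_d).

Lemma innerE M u v :
  inner M u v = \sum_i \sum_j u ord0 i * M i j * v ord0 j.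
Proof.
rewrite /inner mxE exchange_big; apply: eq_bigr => j _.
by rewrite !mxE mulr_suml.
Qed.

Lemma innerDl M u v w : inner M (u + v) w = inner M u w + inner M v w.
Proof. by rewrite /inner !mulmxDl mxE. Qed.

Lemma innerZl M (r : R) u w : inner M (r *: u) w = r * inner M u w.
Proof. by rewrite /inner -!scalemxAl mxE. Qed.

Lemma innerC M u v : M^T = M -> inner M u v = inner M v u.
Proof.
move=> sM; rewrite /inner -[LHS]trace_mx11 -mxtrace_tr trace_mx11.
by rewrite !trmx_mul trmxK sM mulmxA.
Qed.

Lemma innerDr M u v w : M^T = M -> inner M u (v + w) = inner M u v + inner M u w.
Proof. by move=> sM; rewrite innerC// innerDl !(innerC u). Qed.

Lemma innerZr M (r : R) u w : M^T = M -> inner M u (r *: w) = r * inner M u w.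
Proof. by move=> sM; rewrite innerC// innerZl innerC. Qed.

Lemma innerZZ M (r : R) u : M^T = M ->
  inner M (r *: u) (r *: u) = r ^+ 2 * inner M u u.
Proof. by move=> sM; rewrite innerZl innerZr// mulrA -expr2. Qed.

(** Raising indices is an isometry from covectors with the inverse metric to vectors with the
    metric. *)
Lemma inner_invmx M u v : M^T = M -> M \in unitmx ->
  inner (invmx M) u v = inner M (u *m invmx M) (v *m invmx M).
Proof.
move=> sM uM; rewrite /inner mulmxKV// trmx_mul trmx_inv sM.
by rewrite mulmxA.
Qed.

End InnerProduct.

Section LeviCivita.
Context {R : realType} {d : nat} (h : 'rV[R]_d -> 'M[R]_d).
Implicit Types (f : 'rV[R]_d -> R) (x v : 'rV[R]_d) (Y Z : 'rV[R]_d -> 'rV[R]_d).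

Lemma inner_grad f x v : h x \in unitmx ->
  inner (h x) (grad h f x) v = (dform f x *m v^T) ord0 ord0.
Proof. by move=> uh; rewrite /inner /grad mulmxKV. Qed.

Lemma nablaD v Y Z x :
  (forall i, differentiable (fun y => Y y ord0 i : R) x) ->
  (forall i, differentiable (fun y => Z y ord0 i : R) x) ->
  nabla h v (fun y => Y y + Z y) x = nabla h v Y x + nabla h v Z x.
Proof.
move=> dY dZ; apply/rowP => c; rewrite !mxE -big_split; apply: eq_bigr => a _.
rewrite /= -mulrDr; congr (_ * _).
under [X in partial a X]funext do rewrite mxE.
rewrite partialD// [RHS]addrACA; congr (_ + _).
by rewrite -big_split; apply: eq_bigr => b _; rewrite /= mxE mulrDr.
Qed.

Lemma nablaZ v f Y x : differentiable f x ->
  (forall i, differentiable (fun y => Y y ord0 i : R) x) ->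
  nabla h v (fun y => f y *: Y y) x =
    f x *: nabla h v Y x + (\sum_a v ord0 a * partial a f x) *: Y x.
Proof.
move=> df dY; apply/rowP => c; rewrite !mxE mulr_sumr mulr_suml -big_split.
apply: eq_bigr => a _ /=.
under [X in partial a X]funext do rewrite mxE.
have -> : \sum_b christoffel h c a b x * (f x *: Y x) ord0 b =
    f x * \sum_b christoffel h c a b x * Y x ord0 b.
  by rewrite mulr_sumr; apply: eq_bigr => b _; rewrite mxE mulrCA.
by rewrite partialM//; ring.
Qed.

Lemma nabla_coord_vec c Y x k :
  nabla h (coord_vec c) Y x ord0 k =
  partial c (fun y => Y y ord0 k) x + \sum_b christoffel h k c b x * Y x ord0 b.
Proof.
rewrite mxE (bigD1 c)//= mxE !eqxx mul1r [X in _ + X]big1 ?addr0// => i /negbTE ic.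
by rewrite mxE ic andbF mul0r.
Qed.

(** The derivative splits into its coordinate part [dY'] and its Christoffel part [G]. When [G] is
    paired with [Y], two terms of the Christoffel bracket are antisymmetric and cancel, so that only
    the derivative of [h] along [c] remains; the Leibniz rule produces the same terms on the
    left. *)
Lemma metric_compatibility c Y x : h x \in unitmx ->
  (\forall y \near x, (h y)^T = h y) ->
  (forall i j, differentiable (fun y => h y i j) x) ->
  (forall i, differentiable (fun y => Y y ord0 i : R) x) ->
  partial c (fun y => inner (h y) (Y y) (Y y)) x =
  2 * inner (h x) (nabla h (coord_vec c) Y x) (Y x).
Proof.
move=> uh nsh dh dY; have sh := nbhs_singleton nsh.
pose dY' : 'rV[R]_d := \row_k partial c (fun y => Y y ord0 k) x.
pose G : 'rV[R]_d := \row_k \sum_b christoffel h k c b x * Y x ord0 b.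
have -> : nabla h (coord_vec c) Y x = dY' + G.
  by apply/rowP => k; rewrite nabla_coord_vec !mxE.
have GY : 2 * inner (h x) G (Y x) =
    \sum_i \sum_j Y x ord0 i * partial c (fun y => h y i j) x * Y x ord0 j.
  pose L e b := partial c (fun y => h y e b) x + partial b (fun y => h y c e) x
     - partial e (fun y => h y c b) x.
  (* [w] is [G] with its index lowered by [h]. *)
  pose w : 'rV[R]_d := \row_e \sum_b 2^-1 * L e b * Y x ord0 b.
  have -> : G = w *m invmx (h x).
    rewrite -[h x in RHS]sh -trmx_inv; apply/rowP => k; rewrite !mxE.
    under eq_bigr do rewrite /christoffel mulr_sumr mulr_suml.
    rewrite exchange_big; apply: eq_bigr => e _ /=; rewrite !mxE mulr_suml.
    by apply: eq_bigr => b _; rewrite /L; ring.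
  rewrite /inner mulmxKV// mxE mulr_sumr.
  transitivity (\sum_e \sum_b (Y x ord0 e * partial c (fun y => h y e b) x * Y x ord0 b)
    + (\sum_e \sum_b (partial b (fun y => h y c e) x * Y x ord0 b * Y x ord0 e)
    - \sum_e \sum_b (partial e (fun y => h y c b) x * Y x ord0 b * Y x ord0 e))).
    rewrite -sumrB -big_split; apply: eq_bigr => e _ /=.
    rewrite -sumrB -big_split !mxE mulr_suml mulr_sumr; apply: eq_bigr => b _ /=.
    by rewrite /L; field.
  rewrite [X in _ + (_ - X)]exchange_big/= [X in _ + X](_ : _ = 0) ?addr0//.
  apply/eqP; rewrite subr_eq0; apply/eqP; apply: eq_bigr => i _.
  by apply: eq_bigr => j _; rewrite mulrAC.
rewrite innerDl mulrDr GY.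
have -> : 2 * inner (h x) dY' (Y x) = inner (h x) dY' (Y x) + inner (h x) (Y x) dY'.
  by rewrite [X in _ + X]innerC// mulr_natl mulr2n.
under [X in partial c X]funext do rewrite innerE.
have dYhY i j : differentiable (fun y => Y y ord0 i * h y i j * Y y ord0 j) x.
  by apply: differentiableM => //; exact: differentiableM.
rewrite partial_sum; last by move=> i _; exact: differentiable_sumr.
rewrite !innerE -!big_split; apply: eq_bigr => i _ /=.
rewrite partial_sum// -!big_split; apply: eq_bigr => j _ /=.
rewrite partialM//; last exact: differentiableM.
by rewrite partialM// !mxE; ring.
Qed.

(** Differentiating the coefficients [p] and [q] along [e_a] only yields multiples of [Y] and [Z],
    which are orthogonal to the frame. *)
Lemma second_form_normal k (E : 'M[R]_(k, d)) (p q : 'rV[R]_d -> R) Y Z x :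
  differentiable p x -> differentiable q x ->
  (forall i, differentiable (fun y => Y y ord0 i : R) x) ->
  (forall i, differentiable (fun y => Z y ord0 i : R) x) ->
  (forall b, inner (h x) (Y x) (row b E) = 0) ->
  (forall b, inner (h x) (Z x) (row b E) = 0) ->
  second_form h E (fun y => p y *: Y y + q y *: Z y) x =
  p x *: second_form h E Y x + q x *: second_form h E Z x.
Proof.
move=> dp dq dY dZ YE ZE.
have dpY i : differentiable (fun y => (p y *: Y y) ord0 i : R) x.
  rewrite (_ : (fun _ => _) = fun y => p y * Y y ord0 i).
    exact: differentiableM.
  by apply/funext => y; rewrite mxE.
have dqZ i : differentiable (fun y => (q y *: Z y) ord0 i : R) x.
  rewrite (_ : (fun _ => _) = fun y => q y * Z y ord0 i).
    exact: differentiableM.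
  by apply/funext => y; rewrite mxE.
apply/matrixP => a b; rewrite !mxE nablaD// !nablaZ//.
by rewrite !innerDl !innerZl YE ZE !mulr0 !addr0.
Qed.

Lemma frame_traceD k (E : 'M[R]_(k, d)) x (p q : R) (B C : 'M[R]_k) :
  frame_trace h E x (p *: B + q *: C) =
  p * frame_trace h E x B + q * frame_trace h E x C.
Proof. by rewrite /frame_trace mulmxDr -!scalemxAr mxtraceD !mxtraceZ. Qed.

End LeviCivita.

(** * The surfaces and their null normals *)

Lemma open_gt0 (R : realType) (d : nat) (A : set 'rV[R]_d) (f : 'rV[R]_d -> R) :
  open A -> Ck 0 A f -> open [set x | A x /\ 0 < f x].
Proof.
move=> oA cf; rewrite openE => x [Ax fx]; apply: filterI.
  exact: open_nbhs_nbhs.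
exact: cvgr_gt (cf x Ax) _ fx.
Qed.

Lemma differentiable_sqrt (R : realType) (d : nat) (f : 'rV[R]_d -> R) x :
  0 < f x -> differentiable f x -> differentiable (fun y => Num.sqrt (f y)) x.
Proof.
move=> fx0 df; apply: (@differentiable_comp _ _ _ _ f Num.sqrt) => //.
by apply/derivable1_diffP; have [] := is_derive1_sqrt fx0.
Qed.

Lemma differentiable_inner (R : realType) (d : nat) (h : 'rV[R]_d -> 'M[R]_d)
    (Y Z : 'rV[R]_d -> 'rV[R]_d) x :
  (forall i j, differentiable (fun y => h y i j) x) ->
  (forall i, differentiable (fun y => Y y ord0 i : R) x) ->
  (forall i, differentiable (fun y => Z y ord0 i : R) x) ->
  differentiable (fun y => inner (h y) (Y y) (Z y)) x.
Proof.
move=> dh dY dZ; under [X in differentiable_def X]funext do rewrite innerE.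
apply: differentiable_sumr => i _; apply: differentiable_sumr => j _.
by apply: differentiableM => //; exact: differentiableM.
Qed.

Section SmoothMetric.
Context {R : realType} {d : nat} (h : 'rV[R]_d -> 'M[R]_d) (A : set 'rV[R]_d).
Context (oA : open A) (hC : forall i j, smooth A (fun y => h y i j))
  (uh : forall y, A y -> h y \in unitmx).

Lemma smooth_differentiable f x : smooth A f -> A x -> differentiable f x.
Proof. by move=> /(_ 1)[+ _]; exact. Qed.

Lemma smooth_inner (Y Z : 'rV[R]_d -> 'rV[R]_d) :
  (forall i, smooth A (fun y => Y y ord0 i)) ->
  (forall i, smooth A (fun y => Z y ord0 i)) ->
  smooth A (fun y => inner (h y) (Y y) (Z y)).
Proof.
move=> CY CZ k; apply: Ck_mulmx => // [i j|i j].
  apply: Ck_mulmx => // [i' j'|i' j']; last exact: hC.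
  by rewrite (ord1 i'); exact: CY.
apply: (@Ck_eq_on _ _ _ _ (fun y => Z y ord0 i)) => // [y _|]; last exact: CZ.
by rewrite mxE (ord1 j).
Qed.

Lemma smooth_grad f i : smooth A f -> smooth A (fun y => grad h f y ord0 i).
Proof.
move=> Cf k; apply: Ck_mulmx => // [i' j|i' j]; last first.
  by apply: Ck_invmx => // a b; exact: hC.
apply: (@Ck_eq_on _ _ _ _ (partial j f)) => // [y _|]; first by rewrite mxE.
by have [_ /(_ j)] := Cf k.+1.
Qed.

End SmoothMetric.

Section GaugeCoordinates.
Context {R : realType} {n : nat} (h : 'rV[R]_n.+1 -> 'M[R]_n.+1)
  (A : set 'rV[R]_n.+1).
Context (oA : open A) (hC : forall i j, smooth A (fun y => h y i j))
  (uh : forall y, A y -> h y \in unitmx) (sh : forall y, A y -> (h y)^T = h y)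
  (w0_gt0 : forall y, A y -> 0 < y ord0 ord0)
  (w1_gt0 : forall y, A y -> 0 < y ord0 (inord 1)).
Local Notation m := (m_fun h).
Local Notation gw := (grad h (@omega0 R n)).
Local Notation gm := (grad h m).

Lemma smooth_omega0 : smooth A (@omega0 R n).
Proof. by move=> k; exact: Ck_coord. Qed.

Lemma scale_gt0 y : A y -> 0 < scale y.
Proof. by move=> Ay; rewrite invr_gt0 mulr_gt0// ?w1_gt0// /omega0 w0_gt0. Qed.

Lemma smooth_scale : smooth A (@scale R n).
Proof.
move=> k; apply: CkV => // [x Ax|].
  by rewrite mulf_neq0// gt_eqF// ?w1_gt0// /omega0 w0_gt0.
by apply: CkM => //; exact: Ck_coord.
Qed.

(** [m] is defined through the inverse metric on covectors; raising the indices ties its sign to the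
    causal character of [gw]. *)
Lemma m_funE y : A y -> m y = scale y ^+ 2 * inner (h y) (gw y) (gw y).
Proof.
move=> Ay; rewrite /m_fun inner_invmx ?sh ?uh// -!scalemxAl.
exact: innerZZ (sh Ay).
Qed.

Lemma m_fun_scaled_grad y : A y ->
  m y = inner (h y) (scaled_grad h y) (scaled_grad h y).
Proof. by move=> Ay; rewrite m_funE// innerZZ// sh. Qed.

Lemma smooth_gw i : smooth A (fun y => gw y ord0 i).
Proof. by apply: smooth_grad => //; exact: smooth_omega0. Qed.

Lemma smooth_m : smooth A m.
Proof.
move=> k; apply: (Ck_eq_on oA (f := fun y => scale y * scale y * inner (h y) (gw y) (gw y))).
  by move=> y Ay; rewrite m_funE// expr2.
have Cs := smooth_scale k; apply: CkM => //; first exact: CkM.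
by apply: smooth_inner => // i; exact: smooth_gw.
Qed.

Lemma smooth_gm i : smooth A (fun y => gm y ord0 i).
Proof. by apply: smooth_grad => //; exact: smooth_m. Qed.

(** The identity [m = h(X, X)] holds on the open set [A], so it can be differentiated there by
    metric compatibility. This lets a sign condition on the derivative of the scaled gradient
    control the monotonicity of [m]. *)
Lemma partial_m_fun c y : A y ->
  partial c m y =
  2 * inner (h y) (nabla h (coord_vec c) (scaled_grad h) y) (scaled_grad h y).
Proof.
move=> Ay; rewrite (partial_eq_on c oA m_fun_scaled_grad Ay).
apply: metric_compatibility; first exact: uh.
- by apply: filterS (open_nbhs_nbhs (conj oA Ay)) => z; exact: sh.
- by move=> i j; exact: smooth_differentiable (hC i j) Ay.
- move=> i; rewrite (_ : (fun _ => _) = fun z => scale z * gw z ord0 i); last first.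
    by apply/funext => z; rewrite mxE.
  apply: differentiableM; first exact: smooth_differentiable smooth_scale Ay.
  exact: smooth_differentiable (smooth_gw i) Ay.
Qed.

Lemma gw_spacelike y : A y -> 0 < m y -> 0 < inner (h y) (gw y) (gw y).
Proof.
by move=> Ay; rewrite m_funE// pmulr_rgt0// exprn_gt0// scale_gt0.
Qed.

Lemma partial_surface_eqs mu nu j c y : A y ->
  partial c (surface_eqs h mu nu j) y =
  (j == ord0)%:R * partial c (@omega0 R n) y + partial c m y.
Proof.
move=> Ay; have dm := smooth_differentiable smooth_m Ay.
have dw := smooth_differentiable smooth_omega0 Ay.
rewrite /surface_eqs; case: eqP => _; rewrite ?mul1r ?mul0r ?add0r.
  by rewrite partialD ?partial_cst ?addr0 ?partialD//; exact: differentiableD.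
by rewrite partialD ?partial_cst ?addr0.
Qed.

Lemma smooth_surface_eqs mu nu j : smooth A (surface_eqs h mu nu j).
Proof.
move=> k; rewrite /surface_eqs; case: (j == ord0).
  apply: CkD => //; last exact: Ck_cst.
  by apply: CkD => //; [exact: smooth_omega0 | exact: smooth_m].
by apply: CkD => //; [exact: smooth_m | exact: Ck_cst].
Qed.

(** A vector of the kernel annihilates the differentials of [omega0 + m] and of [m], hence by
    subtraction that of [omega0]; pairing with a differential is the inner product with the
    gradient. *)
Lemma tangent_H_orthogonal mu nu y v : A y -> (v <= tangent_H h mu nu y)%MS ->
  inner (h y) (gw y) v = 0 /\ inner (h y) (gm y) v = 0.
Proof.
move=> Ay; rewrite /tangent_H => /sub_kermxP /rowP vD.
have vdE (j : 'I_2) : (j == ord0)%:R * inner (h y) (gw y) v + inner (h y) (gm y) v = 0.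
  have := vD j; rewrite !mxE => <-; rewrite !inner_grad ?uh// !mxE mulr_sumr.
  rewrite -big_split; apply: eq_bigr => c _ /=.
  by rewrite !mxE partial_surface_eqs//; ring.
have := vdE ord_max; rewrite /= mul0r add0r => vm; split => //.
by have := vdE ord0; rewrite eqxx mul1r vm addr0.
Qed.

(** Raising the index of a vanishing combination of the differentials gives
    [u0 gw = - (u0 + u1) gm]. The squared length of the left side is nonnegative and that of the
    right side nonpositive, which forces both coefficients to vanish. *)
Lemma rank_surface_eqs mu nu y : A y -> 0 < m y ->
  inner (h y) (gm y) (gm y) < 0 ->
  \rank (differentials (surface_eqs h mu nu) y) = 2.
Proof.
move=> Ay m0 gm0; have gw0 := gw_spacelike Ay m0.
rewrite -mxrank_tr; apply/eqP; rewrite -/(row_free _); apply/inj_row_free => u uD.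
pose u0 := u ord0 ord0; pose u1 := u ord0 ord_max.
have : u0 *: gw y + (u0 + u1) *: gm y = 0.
  rewrite /grad !scalemxAl -mulmxDl (_ : _ + _ = 0) ?mul0mx//.
  rewrite -[RHS]uD; apply/rowP => c; rewrite !mxE big_ord_recl big_ord1.
  rewrite !mxE !partial_surface_eqs// eqxx /= mul1r mul0r add0r.
  by rewrite (_ : lift ord0 ord0 = ord_max) ?/u0 ?/u1; [ring|exact/val_inj].
move/eqP; rewrite addr_eq0 => /eqP ugw.
have : u0 ^+ 2 * inner (h y) (gw y) (gw y) =
       (u0 + u1) ^+ 2 * inner (h y) (gm y) (gm y).
  have := congr1 (fun v => inner (h y) v v) ugw.
  by rewrite -scaleNr !(innerZZ _ _ (sh Ay)) sqrrN.
move=> eq_u; have u0_0 : u0 = 0.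
  apply/eqP; rewrite -sqrf_eq0 eq_le sqr_ge0 andbT -(pmulr_rle0 _ gw0) mulrC eq_u.
  by rewrite mulr_ge0_le0//; [exact: sqr_ge0 | exact: ltW].
have u1_0 : u1 = 0.
  move/eqP: eq_u; rewrite u0_0 expr0n mul0r add0r eq_sym mulf_eq0.
  by rewrite (lt_eqF gm0) orbF sqrf_eq0 => /eqP.
apply/rowP => -[[|[|//]] lt_j]; rewrite [RHS]mxE.
- by apply: etrans u0_0; congr (u _ _); exact/val_inj.
- by apply: etrans u1_0; congr (u _ _); exact/val_inj.
Qed.

(** The rank condition is required on a whole ambient neighbourhood, not only on the surface, so [O]
    is cut out of the open set [A] by the open conditions that [m] is positive and [gm] timelike. *)
Lemma surface_H_submanifold mu nu (W : set 'rV[R]_n.+1) :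
  W `<=` A -> 0 < nu ->
  (forall y, W y -> 0 <= m y -> timelike h y (gm y)) ->
  smooth_submanifold 2 W (surface_H h W mu nu).
Proof.
move=> WA nu0 tm; split=> [y []//|p [Wp wmp mp]].
pose B := [set y | A y /\ 0 < m y].
have oB : open B by apply: open_gt0 => //; exact: smooth_m.
have BA : B `<=` A by move=> y [].
pose O := [set y | B y /\ 0 < - inner (h y) (gm y) (gm y)].
have oO : open O.
  apply: open_gt0 => //; apply: (Ck_sub BA); apply: CkN => //.
  by apply: smooth_inner => // i; exact: smooth_gm.
have mp0 : 0 < m p by rewrite mp.
exists O, (surface_eqs h mu nu); split => //.
- split; first by split => //; exact: WA.
  by rewrite oppr_gt0; apply: tm => //; exact: ltW.
- by move=> j k; apply: (@Ck_sub _ _ _ _ A) => [y [/BA]//|]; exact: smooth_surface_eqs.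
- by move=> y [[Ay my] gmy]; apply: rank_surface_eqs; rewrite // -oppr_gt0.
- move=> y _; split=> [[Wy wmy my]|[Wy Fy]].
    by split => // j; rewrite /surface_eqs wmy my; case: ifP; rewrite subrr.
  have := Fy ord0; have := Fy ord_max; rewrite /surface_eqs/= => /subr0_eq my.
  by move=> /subr0_eq wmy; split.
Qed.

(** * Signs and regularity of the null coefficients, and the null mean curvatures *)

Section NullNormals.
Context (mu nu : R) (y : 'rV[R]_n.+1).
Context (Ay : A y) (m_gt0 : 0 < m y) (gm_lt0 : inner (h y) (gm y) (gm y) < 0).

Let N_gt0 : 0 < inner (h y) (gw y) (gw y). Proof. exact: gw_spacelike. Qed.

(** The extra term [- h(gw, gw) h(gm, gm)] is positive because [gw] is spacelike and [gm] timelike.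
    Hence the square root exceeds the absolute value of [h(gw, gm)] and decides the signs of
    [b_plus] and [b_minus]. *)
Lemma b_disc_gt : inner (h y) (gw y) (gm y) ^+ 2 < b_disc h y.
Proof. by rewrite /b_disc ltrDl oppr_gt0 pmulr_rlt0. Qed.

Let b_disc_gt0 : 0 < b_disc h y.
Proof. exact: le_lt_trans (sqr_ge0 _) b_disc_gt. Qed.

Let sqrt_b_disc_gt : `|inner (h y) (gw y) (gm y)| < Num.sqrt (b_disc h y).
Proof. by rewrite -sqrtr_sqr ltr_sqrt// b_disc_gt. Qed.

Lemma b_plus_gt0 : 0 < b_plus h y.
Proof.
rewrite divr_gt0// addrC subr_gt0.
exact: le_lt_trans (ler_norm _) sqrt_b_disc_gt.
Qed.

Lemma b_minus_lt0 : b_minus h y < 0.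
Proof.
rewrite pmulr_llt0 ?invr_gt0// subr_lt0.
by apply: le_lt_trans sqrt_b_disc_gt; rewrite -normrN ler_norm.
Qed.

Let dh i j : differentiable (fun z => h z i j) y.
Proof. exact: smooth_differentiable (hC i j) Ay. Qed.

Let dgw i : differentiable (fun z => gw z ord0 i : R) y.
Proof. exact: smooth_differentiable (smooth_gw i) Ay. Qed.

Let dgm i : differentiable (fun z => gm z ord0 i : R) y.
Proof. exact: smooth_differentiable (smooth_gm i) Ay. Qed.

Let db_disc : differentiable (b_disc h) y.
Proof.
have dP := differentiable_inner dh dgw dgm.
apply: differentiableB; first exact: (differentiableM dP dP).
by apply: differentiableM; exact: differentiable_inner.
Qed.

Lemma differentiable_b_plus : differentiable (b_plus h) y.
Proof.
apply: differentiableM; last first.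
  by apply: differentiableV; [exact: differentiable_inner | rewrite gt_eqF].
apply: differentiableD; last exact: differentiable_sqrt.
by apply: differentiableN; exact: differentiable_inner.
Qed.

Lemma differentiable_b_minus : differentiable (b_minus h) y.
Proof.
apply: differentiableM; last first.
  by apply: differentiableV; [exact: differentiable_inner | rewrite gt_eqF].
apply: differentiableB; last exact: differentiable_sqrt.
by apply: differentiableN; exact: differentiable_inner.
Qed.

(* The normalization determines the scaling: a = sqrt (-2 / q), where q is the
   product of the unscaled null normals. *)
Lemma differentiable_null_scaling a : null_scaling h a y -> differentiable a y.
Proof.
move=> ay.
pose q z := inner (h z) (b_plus h z *: gw z + gm z) (b_minus h z *: gw z + gm z).
have dl (b : 'rV[R]_n.+1 -> R) i : differentiable b y ->
    differentiable (fun z => (b z *: gw z + gm z) ord0 i : R) y.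
  move=> db; rewrite (_ : (fun _ => _) = fun z => b z * gw z ord0 i + gm z ord0 i).
    by apply: differentiableD => //; exact: differentiableM.
  by apply/funext => z; rewrite !mxE.
have dq : differentiable q y.
  by apply: differentiable_inner => // i; apply: dl;
    [exact: differentiable_b_plus | exact: differentiable_b_minus].
(* By bilinearity the normalization reads [a^2 q = -2], which also shows that [q] does not vanish
   near [y]. *)
have aq : \forall z \near y, 0 < a z /\ a z ^+ 2 = -2 / q z.
  have nA := open_nbhs_nbhs (conj oA Ay).
  apply: filterS2 nA ay => z Az [az0].
  rewrite /l_plus /l_minus innerZl innerZr ?sh// mulrA -expr2 -/(q z) => aq.
  split => //; rewrite -aq mulfK//; apply/eqP => qz; move: aq; rewrite qz mulr0.
  by move/eqP; rewrite eq_sym oppr_eq0 pnatr_eq0.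
have [a0 aqy] := nbhs_singleton aq.
have q0 : q y != 0.
  by apply/eqP => q0; move: (exprn_gt0 2 a0); rewrite aqy q0 invr0 mulr0 ltxx.
(* Positivity of [a] selects the positive root. *)
apply: (@near_eq_differentiable _ _ _ (fun z => Num.sqrt (-2 / q z))).
  by apply: filterS aq => z [az0 <-]; rewrite sqrtr_sqr gtr0_norm.
apply: differentiable_sqrt; first by rewrite -aqy exprn_gt0.
by apply: differentiableM => //; exact: differentiableV.
Qed.

(** Distributing [a] gives the coefficients [a b] and [a], to which [second_form_normal] applies; no
    derivative of [a] or [b] survives. *)
Lemma null_frame_trace (a b : 'rV[R]_n.+1 -> R) (E : 'M[R]_(n.-1, n.+1)) :
  differentiable a y -> differentiable b y -> tangent_frame h mu nu y E ->
  frame_trace h E y (second_form h E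
    (fun z => a z *: (b z *: gw z + gm z)) y) =
  a y * (b y * frame_trace h E y (second_form h E gw y)
         + frame_trace h E y (second_form h E gm y)).
Proof.
move=> da db [_ ET].
have orth k : inner (h y) (gw y) (row k E) = 0 /\ inner (h y) (gm y) (row k E) = 0.
  apply: (@tangent_H_orthogonal mu nu) => //.
  by apply: submx_trans (row_sub k E) _; rewrite ET.
rewrite (_ : (fun _ => _) = fun z => (a z * b z) *: gw z + a z *: gm z); last first.
  by apply/funext => z; rewrite scalerDr scalerA.
have dab : differentiable (fun z => a z * b z) y by exact: differentiableM.
have -> := second_form_normal dab da dgw dgm (fun k => (orth k).1) (fun k => (orth k).2).
by rewrite frame_traceD mulrDr mulrA.
Qed.

(** Since [a] is positive at [y], only the sign of [b trU + trV] matters. The upper bound on [trU],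
    multiplied by [b_plus > 0], gives the claim for [l_plus]; multiplying by [b_minus < 0] reverses
    the inequality, so the lower bound gives the claim for [l_minus]. *)
Lemma trapped a (E : 'M[R]_(n.-1, n.+1)) :
  null_scaling h a y -> tangent_frame h mu nu y E ->
  let trU := frame_trace h E y (second_form h E gw y) in
  let trV := frame_trace h E y (second_form h E gm y) in
  trU \in `](- (trV / b_minus h y)), (- (trV / b_plus h y))[ ->
  frame_trace h E y (second_form h E (l_plus h a) y) < 0 /\
  frame_trace h E y (second_form h E (l_minus h a) y) < 0.
Proof.
move=> ay TE trU trV; rewrite in_itv => /andP[Ul Uu].
have [a0 _] := nbhs_singleton ay.
have da := differentiable_null_scaling ay.
have -> : frame_trace h E y (second_form h E (l_plus h a) y) =
    a y * (b_plus h y * trU + trV) := null_frame_trace da differentiable_b_plus TE.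
have -> : frame_trace h E y (second_form h E (l_minus h a) y) =
    a y * (b_minus h y * trU + trV) := null_frame_trace da differentiable_b_minus TE.
have bp := b_plus_gt0; have bm := b_minus_lt0.
move: (b_plus h y) (b_minus h y) trU trV bp bm Ul Uu => bp bm trU trV bp0 bm0 Ul Uu.
rewrite !(pmulr_rlt0 _ a0) -!ltrBrDr !sub0r [bp * _]mulrC [bm * _]mulrC.
by rewrite -ltr_pdivlMr// -ltr_ndivrMr// !mulNr.
Qed.

End NullNormals.

End GaugeCoordinates.

(** * The gauge coordinates *)

Section LorentzianBlock.
Context {R : realType} {n : nat}.
Implicit Types (al be : R) (B : 'M[R]_n) (u v : 'rV[R]_n.+1).

Lemma posdef_ge0 B (w : 'rV[R]_n) : posdef_sym B -> 0 <= inner B w w.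
Proof.
move=> [_ Bpos]; have [->|/Bpos/ltW//] := eqVneq w 0.
by rewrite /inner !mul0mx mxE.
Qed.

Lemma posdef_unitmx B : posdef_sym B -> B \in unitmx.
Proof.
move=> [_ Bpos]; rewrite -row_free_unit; apply/inj_row_free => v vB.
apply/eqP; apply: contraT => /Bpos.
by rewrite /inner vB mul0mx mxE ltxx.
Qed.

Lemma inner_block al B u v :
  inner (block_mx al%:M 0 0 B : 'M[R]_(1 + n)) u v =
  al * u ord0 ord0 * v ord0 ord0 + inner B (spatial u) (spatial v).
Proof.
have split_row (w : 'rV[R]_(1 + n)) : w = row_mx (w ord0 ord0)%:M (spatial w).
  rewrite -[LHS]hsubmxK; congr row_mx; apply/rowP => i; rewrite !mxE.
    by rewrite ord1 eqxx mulr1n; congr (w _ _); exact/val_inj.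
  by congr (w _ _); exact/val_inj.
rewrite {1}/inner {1}(split_row u) {1}(split_row v).
rewrite tr_row_mx mul_row_block !mulmx0 addr0 add0r mul_row_col mxE.
congr (_ + _); rewrite -mulmxA mul_scalar_mx tr_scalar_mx mul_scalar_mx.
by rewrite !mxE eqxx mulr1n mulrCA mulrA.
Qed.

(* With T timelike and orthogonal to v, the vector v_0 T' - T_0 v' (primes
   denote the spatial parts) has nonnegative length for B. *)
Lemma orthogonal_timelike_spacelike al B (T v : 'rV[R]_n.+1) :
  posdef_sym B ->
  let M : 'M[R]_(1 + n) := block_mx al%:M 0 0 B in
  inner M T T < 0 -> inner M T v = 0 -> v != 0 -> 0 < inner M v v.
Proof.
move=> pB M; rewrite /M !inner_block => TT Tv v_neq0; have [sB Bpos] := pB.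
have := posdef_ge0 (v ord0 ord0 *: spatial T - T ord0 ord0 *: spatial v) pB.
rewrite -scaleNr innerDl !innerZl !innerDr// !innerZr// (innerC (spatial v))//.
have := posdef_ge0 (spatial T) pB.
(* Without time component, [v] has a nonzero spatial part and [B] alone decides. *)
have : v ord0 ord0 = 0 -> 0 < inner B (spatial v) (spatial v).
  move=> v0; apply: Bpos; apply: contra_neq v_neq0 => /rowP sv.
  apply/rowP => i; rewrite mxE; have [j ->|->//] := unliftP ord0 i.
  by have := sv j; rewrite !mxE.
move: TT Tv; set t := T _ _; set v0 := v _ _.
set TT := inner B _ _; set TV := inner B _ _; set VV := inner B _ _.
move=> h1 h2 h3 TT0 h4.
have t_neq0 : t != 0.
  by apply: contraTneq h1 => ->; rewrite mulr0 add0r -leNgt.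
have t2 : 0 < t ^+ 2 by rewrite exprn_even_gt0.
have [v00|v0_neq0] := eqVneq v0 0.
  by rewrite v00 mulr0 add0r h3.
have v2 : 0 < v0 ^+ 2 by rewrite exprn_even_gt0.
have TVE : TV = - (al * t * v0) by apply/eqP; rewrite -addr_eq0 addrC h2.
rewrite -(pmulr_rgt0 _ t2).
(* Once [TV] is substituted, [h4] gives [t^2 (al v0^2 + VV) >= - v0^2 (al t^2 + TT)], whose right
   side is positive. *)
have : v0 ^+ 2 * (al * t * t + TT) < 0 by rewrite pmulr_rlt0.
move: h4; rewrite TVE; nra.
Qed.

End LorentzianBlock.

(** * The conformal metric read in the gauge chart *)

Section Gauge.
Context {R : realType} {n : nat} (Omega : 'rV[R]_n -> R)
  (gbar : 'rV[R]_n.+1 -> 'M[R]_n).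
Implicit Types (x y u v : 'rV[R]_n.+1).

(** The factor [Omega^2] cancels the denominator of the time coefficient. *)
Lemma metric_h_block x : Omega (spatial x) != 0 ->
  metric_h Omega gbar x = block_mx (- \det (gbar x))%:M 0 0
    (Omega (spatial x) ^+ 2 *: gbar x) :> 'M[R]_(1 + n).
Proof.
move=> Om0; rewrite /metric_h /metric_g.
apply: (etrans (@scale_block_mx _ 1 n 1 n _ _ _ _ _)); rewrite !scaler0.
rewrite scale_scalar_mx mulrN mulrCA mulfV ?mulr1// expf_neq0//.
Qed.

Lemma posdefZ (r : R) (B : 'M[R]_n) : 0 < r -> posdef_sym B ->
  posdef_sym (r *: B).
Proof.
move=> r0 [sB pB]; split=> [|v v0]; first by rewrite linearZ/= sB.
by rewrite /inner -scalemxAr -scalemxAl mxE mulr_gt0// pB.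
Qed.

Lemma metric_h_sym x : Omega (spatial x) != 0 -> posdef_sym (gbar x) ->
  (metric_h Omega gbar x)^T = metric_h Omega gbar x.
Proof.
move=> Om0 [sg _]; rewrite metric_h_block//.
apply: (etrans (@tr_block_mx _ 1 n 1 n _ _ _ _)).
by rewrite !trmx0 tr_scalar_mx linearZ/= sg.
Qed.

Lemma metric_h_unitmx x : Omega (spatial x) != 0 -> posdef_sym (gbar x) ->
  metric_h Omega gbar x \in unitmx.
Proof.
move=> Om0 /posdef_unitmx; rewrite metric_h_block// !unitmxE.
rewrite [X in _ -> X \is a _](@det_ublock _ 1 n) det_scalar1 detZ !unitfE => g0.
by rewrite !mulf_neq0// ?oppr_eq0// expf_neq0// expf_neq0.
Qed.

Lemma inner_pullback psi (h : 'rV[R]_n.+1 -> 'M[R]_n.+1) y u v :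
  inner (pullback psi h y) u v =
  inner (h (psi y)) (u *m 'J psi y) (v *m 'J psi y).
Proof. by rewrite /inner /pullback trmx_mul !mulmxA. Qed.

Lemma jacobian_partial (phi : 'rV[R]_n.+1 -> 'rV[R]_n.+1) x i j :
  differentiable phi x ->
  'J phi x i j = partial i (fun y => phi y ord0 j) x.
Proof.
move=> dphi; rewrite mxE -deriveE// derive_mx ?mxE//; exact: diff_derivable.
Qed.

Context (U : set 'rV[R]_n.+1) (psi : 'rV[R]_n.+1 -> 'rV[R]_n.+1).
Local Notation phi := (gauge Omega).
Local Notation h := (pullback psi (metric_h Omega gbar)).
Context (n_gt0 : (0 < n)%N) (gC : forall i j, smooth U (fun x => gbar x i j))
  (pg : forall x, U x -> posdef_sym (gbar x))
  (OmC : smooth U (fun x => Omega (spatial x)))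
  (cs : coordinate_system U phi psi).

Lemma gauge0 x : phi x ord0 ord0 = expR (- (Omega (spatial x) * x ord0 ord0)).
Proof. by rewrite mxE. Qed.

Lemma gauge1 x : phi x ord0 (inord 1) = Omega (spatial x).
Proof. by rewrite mxE inordK. Qed.

(** [Vhat] may have a boundary, so derivatives are taken on this open set around it. Positivity of
    [omega^1 = Omega] is imposed here because it is assumed over [D] only, not over all of [U]. *)
Definition chart_domain : set 'rV[R]_n.+1 :=
  [set y | (phi @` U) y /\ 0 < y ord0 (inord 1)].
Local Notation A := chart_domain.

Lemma chart_domainP y : A y -> [/\ U (psi y), phi (psi y) = y
  & 0 < Omega (spatial (psi y))].
Proof.
case: cs => _ _ _ _ K [[x Ux <-]]; rewrite gauge1 => Om0.
by rewrite K.
Qed.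

Lemma open_chart_domain : open A.
Proof. by case: cs => _ ? _ _ _; apply: open_gt0 => //; exact: (@Ck_coord _ _ 0). Qed.

Lemma smooth_psi i : smooth A (fun y => psi y ord0 i).
Proof.
by case: cs => _ _ _ psiC _ k; apply: Ck_sub (psiC i k) => y [].
Qed.

Lemma differentiable_psi y : A y -> differentiable psi y.
Proof.
move=> Ay; apply: differentiable_coordinates => i.
exact: smooth_differentiable (smooth_psi i) Ay.
Qed.

(** Differentiate [psi (phi x) = x]; with row vectors the chain rule reads
    ['J phi x *m 'J psi y = 1]. *)
Lemma jacobian_psi_unitmx y : A y -> 'J psi y \in unitmx.
Proof.
move=> Ay; have [Ux phiK _] := chart_domainP Ay.
have [oU _ phiC _ psiK] := cs; set x := psi y in Ux phiK *.
have dphi : differentiable phi x.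
  apply: differentiable_coordinates => i; exact: smooth_differentiable (phiC i) Ux.
have dpsi : differentiable psi (phi x) by rewrite phiK; exact: differentiable_psi.
suff J1 : 'J phi x *m 'J psi y = 1%:M by have [] := mulmx1_unit J1.
apply/row_matrixP => i; rewrite row_mul rowE -deriveEjacobian// -phiK.
rewrite -deriveEjacobian// deriveE// deriveE// -[LHS]/(('d psi (phi x) \o 'd phi x) _).
rewrite -diff_comp// -deriveE; last exact: differentiable_comp.
rewrite (@near_eq_derive _ _ _ _ id) ?derive_id ?row1//.
  by apply: filterS (open_nbhs_nbhs (conj oU Ux)) => z /psiK.
exact: dpsi.
Qed.

Lemma smooth_jacobian_psi i j : smooth A (fun y => 'J psi y i j).
Proof.
move=> k; apply: (Ck_eq_on open_chart_domain (f := partial i (fun y => psi y ord0 j))).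
  by move=> y Ay; rewrite jacobian_partial//; exact: differentiable_psi.
by have [_ /(_ i)] := smooth_psi j k.+1.
Qed.

Lemma smooth_comp_psi f : smooth U f -> smooth A (fun y => f (psi y)).
Proof.
move=> Cf k; apply: (Ck_comp open_chart_domain _ _ (Cf k)).
  by move=> y /chart_domainP[].
by move=> i; exact: smooth_psi.
Qed.

(** On the chart domain the block form applies, and its entries are polynomial in [Omega] and in the
    entries of [gbar]. *)
Lemma smooth_metric_h_psi i j : smooth A (fun y => metric_h Omega gbar (psi y) i j).
Proof.
move=> k; have oA := open_chart_domain.
pose M y : 'M[R]_(1 + n) := block_mx (- \det (gbar (psi y)))%:M 0 0
    (Omega (spatial (psi y)) ^+ 2 *: gbar (psi y)).
apply: (Ck_eq_on oA (f := fun y => M y i j)) => [y /chart_domainP[_ _ Om0]|].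
  by rewrite metric_h_block ?gt_eqF.
have CO := smooth_comp_psi OmC k.
have Cg a b := smooth_comp_psi (gC a b) k.
rewrite /M; case: (split_ordP (i : 'I_(1 + n))) => {i} i ->;
  case: (split_ordP (j : 'I_(1 + n))) => {j} j ->.
- apply: (Ck_eq_on oA (f := fun y => - \det (gbar (psi y)))) => [y _|].
    by rewrite block_mxEul !ord1 mxE eqxx mulr1n.
  by apply: CkN => //; exact: Ck_det.
- by apply: (Ck_eq_on oA _ (Ck_cst k A 0)) => y _; rewrite block_mxEur mxE.
- by apply: (Ck_eq_on oA _ (Ck_cst k A 0)) => y _; rewrite block_mxEdl mxE.
- apply: (Ck_eq_on oA (f := fun y => Omega (spatial (psi y)) * Omega (spatial (psi y))
      * gbar (psi y) i j)) => [y _|]; first by rewrite block_mxEdr [RHS]mxE -expr2.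
  by apply: CkM => //; exact: CkM.
Qed.

Lemma smooth_pullback i j : smooth A (fun y => h y i j).
Proof.
move=> k; have oA := open_chart_domain; apply: Ck_mulmx => // [i' j'|i' j'].
  apply: Ck_mulmx => // [a b|a b]; first exact: smooth_jacobian_psi.
  exact: smooth_metric_h_psi.
apply: (Ck_eq_on oA (f := fun y => 'J psi y j' i')) => [y _|]; first by rewrite [RHS]mxE.
exact: smooth_jacobian_psi.
Qed.

Lemma pullback_sym y : A y -> (h y)^T = h y.
Proof.
move=> /chart_domainP[Ux _ Om0]; rewrite /pullback !trmx_mul trmxK.
by rewrite metric_h_sym ?gt_eqF ?mulmxA//; exact: pg.
Qed.

Lemma pullback_unitmx y : A y -> h y \in unitmx.
Proof.
move=> Ay; have [Ux _ Om0] := chart_domainP Ay.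
rewrite /pullback !unitmx_mul unitmx_tr jacobian_psi_unitmx//=.
by rewrite metric_h_unitmx ?gt_eqF//; exact: pg.
Qed.

Lemma chart_domain_w0 y : A y -> 0 < y ord0 ord0.
Proof. by move=> /chart_domainP[_ <- _]; rewrite gauge0 expR_gt0. Qed.

Lemma chart_domain_w1 y : A y -> 0 < y ord0 (inord 1).
Proof. by move=> []. Qed.

(** The Jacobian transports the claim to the block form of the metric, and its invertibility keeps
    [v] nonzero. *)
Lemma pullback_spacelike y (T v : 'rV[R]_n.+1) : A y ->
  inner (h y) T T < 0 -> inner (h y) T v = 0 -> v != 0 -> 0 < inner (h y) v v.
Proof.
move=> Ay; have [Ux _ Om0] := chart_domainP Ay.
rewrite !inner_pullback metric_h_block ?gt_eqF// => TT Tv v0.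
apply: (orthogonal_timelike_spacelike (posdefZ _ (pg Ux)) TT Tv).
  by rewrite exprn_gt0.
by apply: contra_neq v0 => vJ; rewrite -[v](mulmxK (jacobian_psi_unitmx Ay)) vJ mul0mx.
Qed.

(** All gauge coordinates except [omega^0] depend on the spatial variables alone, while [omega^0]
    decreases exponentially in [x^0]; every positive value below the current one is therefore
    reached later. *)
Lemma gauge_time_translation x t : 0 < Omega (spatial x) ->
  0 <= t -> t < phi x ord0 ord0 ->
  exists2 s, 0 <= s & phi (x + s *: coord_vec ord0) = phi x - t *: coord_vec ord0.
Proof.
move=> Om0 t0 tx; set w := phi x ord0 ord0 in tx.
have wt : 0 < w - t by rewrite subr_gt0.
have w0 : 0 < w by exact: le_lt_trans tx.
(* The solution of [w exp (- Omega s) = w - t]. *)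
pose s := (ln w - ln (w - t)) / Omega (spatial x).
have sp : spatial (x + s *: coord_vec ord0) = spatial x.
  by apply/rowP => i; rewrite !mxE /= mulr0 addr0.
exists s.
  by apply: divr_ge0; [rewrite subr_ge0 ler_ln ?posrE// gerBl | exact: ltW].
apply/rowP => i; rewrite mxE sp [RHS]mxE [phi x ord0 i]mxE !mxE /=.
case: ifPn => [/eqP i0|i_neq0].
  have -> : i = ord0 by exact/val_inj.
  have lw : ln w = - (Omega (spatial x) * x ord0 ord0) by rewrite /w gauge0 expRK.
  rewrite eqxx !mulr1 mulrDr /s [_ * (_ / _)]mulrC divfK ?gt_eqF// -gauge0 -/w.
  by rewrite (_ : - _ = ln (w - t)) ?lnK ?posrE// lw; ring.
have -> : (i == ord0) = false by apply/negbTE; apply: contra i_neq0 => /eqP ->.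
by rewrite !mulr0 oppr0 !addr0.
Qed.

End Gauge.

(** The difference quotient with increment [- t] is negative for small [t > 0], so a step against
    the coordinate direction raises [f]. *)
Lemma partial_lt0_decreases (R : realType) (d : nat) (f : 'rV[R]_d -> R) c x e :
  differentiable f x -> partial c f x < 0 -> 0 < e ->
  exists2 t, 0 < t < e & f x < f (x - t *: coord_vec c).
Proof.
move=> df fx0 e0.
have : derivable f x (coord_vec c) by exact: diff_derivable.
move=> /cvgr_lt /(_ 0 fx0) /nbhs_ballP [r /= r0 /=] rP.
(* Halving keeps [t] strictly below both the radius [r] and [e]. *)
pose t := Num.min r e / 2.
have m0 : 0 < Num.min r e by rewrite lt_min r0.
have t0 : 0 < t by rewrite divr_gt0.
have tm : t < Num.min r e by rewrite ltr_pdivrMr// mulr_natr mulr2n ltrDl.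
have [tr te] : t < r /\ t < e by move: tm; rewrite lt_min => /andP[].
clearbody t; exists t; first by rewrite t0.
have scN (z : R) : (- t)^-1 *: z = - (t^-1 * z).
  by rewrite /GRing.scale/= invrN mulNr.
have := rP (- t); rewrite /ball/= sub0r opprK gtr0_norm// => /(_ tr).
rewrite oppr_eq0 gt_eqF// => /(_ isT).
rewrite scN oppr_lt0 pmulr_rgt0 ?invr_gt0// subr_gt0.
by rewrite [x - _]addrC -scaleNr.
Qed.

(** * A nonempty surface, and the trapping of all of them *)

Theorem theoremI1 (R : realType) (n : nat) (I : set R) (D : set 'rV[R]_n)
  (U : set 'rV[R]_n.+1) (Omega : 'rV[R]_n -> R)
  (gbar : 'rV[R]_n.+1 -> 'M[R]_n) (T : 'rV[R]_n.+1 -> 'M[R]_n.+1)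
  (psi tau : 'rV[R]_n.+1 -> 'rV[R]_n.+1) (a : 'rV[R]_n.+1 -> R) :
  let V := spacetime I D in
  let Vhat := gauge Omega @` V in
  let h := pullback psi (metric_h Omega gbar) in
  let m := m_fun h in
  let X := scaled_grad h in
  (* the spacetime V and the conformal factor; V may have a boundary, and
     the data extend smoothly to its open neighbourhood U *)
  (0 < n)%N ->
  I = `[0, +oo[%classic \/ I = `]0, +oo[%classic ->
  D `<=` closure (interior D) ->
  V `<=` U ->
  (forall i j, smooth U (fun x => gbar x i j)) ->
  (forall x, U x -> posdef_sym (gbar x)) ->
  smooth U (fun x => Omega (spatial x)) ->
  (forall s, D s -> 0 < Omega s) ->
  has_ubound (Omega @` D) ->
  (forall e, 0 < e ->
     exists A : R, forall s, D s -> A < eucl_radius s -> Omega s < e) ->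
  (forall x, V x -> partial (inord 1) (fun z => Omega (spatial z)) x != 0) ->
  einstein_equations (metric_g Omega gbar) T V ->
  (* the gauge *)
  coordinate_system U (gauge Omega) psi ->
  Vhat `<=` gauge_box (sup (Omega @` D)) ->
  time_orientation h Vhat tau ->
  (* the hypersurface m = 0 and the function m *)
  [set y | Vhat y /\ m y = 0] !=set0 ->
  smooth_submanifold 1 Vhat [set y | Vhat y /\ m y = 0] ->
  (forall y, Vhat y ->
     inner (h y) (nabla h (coord_vec ord0) X y) (X y) < 0) ->
  (forall y, Vhat y ->
     0 < inner (h y) (nabla h (shift_vector h y) X y) (X y)) ->
  (forall y, Vhat y -> 0 <= m y ->
     timelike h y (grad h m y) /\ future_pointing h tau y (grad h m y)) ->
  (* the surfaces H_{mu nu} *)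
  (forall mu nu, 0 < mu -> 0 < nu -> compact (surface_H h Vhat mu nu)) ->
  (forall mu nu y, 0 < mu -> 0 < nu -> surface_H h Vhat mu nu y ->
     null_scaling h a y) ->
  (forall mu nu y (E : 'M[R]_(n.-1, n.+1)), 0 < mu -> 0 < nu ->
     surface_H h Vhat mu nu y -> tangent_frame h mu nu y E ->
     let trU := frame_trace h E y (second_form h E (grad h (@omega0 R n)) y) in
     let trV := frame_trace h E y (second_form h E (grad h m) y) in
     trV < 0 /\ trU \in `](- (trV / b_minus h y)), (- (trV / b_plus h y))[) ->
  (* formation of trapped surfaces *)
  (exists mu nu, [/\ 0 < mu, 0 < nu & surface_H h Vhat mu nu !=set0]) /\
  (forall mu nu, 0 < mu -> 0 < nu ->
     smooth_submanifold 2 Vhat (surface_H h Vhat mu nu) /\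
     forall y, surface_H h Vhat mu nu y ->
       (forall v : 'rV[R]_n.+1, (v <= tangent_H h mu nu y)%MS -> v != 0 ->
          0 < inner (h y) v v) /\
       (forall E : 'M[R]_(n.-1, n.+1), tangent_frame h mu nu y E ->
          frame_trace h E y (second_form h E (l_plus h a) y) < 0 /\
          frame_trace h E y (second_form h E (l_minus h a) y) < 0)).

Proof.
move=> V Vhat h m X n0 hI _ VU gC pg OmC Om0 _ _ _ _ cs _ _ [p [Vp mp]] _ dX _.
move=> tm _ ns tr.
(* All the local results hold on the open chart domain, hence at every point of [Vhat]. *)
have VA : Vhat `<=` chart_domain Omega U.
  move=> y [x Vx <-]; split; first by exists x => //; exact: VU.
  by rewrite gauge1//; apply: Om0; case: Vx.
have oA := open_chart_domain cs.
have hC := smooth_pullback n0 gC OmC cs.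
have uh := @pullback_unitmx _ _ _ _ _ _ n0 pg cs.
have sh := @pullback_sym _ _ _ _ _ _ n0 pg cs.
have w0 := @chart_domain_w0 _ _ _ _ _ n0 cs.
have w1 := @chart_domain_w1 _ _ Omega U.
have Cm := smooth_m oA hC uh sh w0 w1.
have tmV y : Vhat y -> 0 <= m y -> inner (h y) (grad h m y) (grad h m y) < 0.
  by move=> Vy my; have [] := tm y Vy my.
split.
  have dm : partial ord0 m p < 0.
    by rewrite (partial_m_fun oA hC uh sh w0 w1)// ?pmulr_rlt0 ?dX//; exact: VA.
  (* The bound on [t] is the value of [omega^0] at [p], so that [omega^0] stays positive after the
     step. *)
  have [t /andP[t0 tp] mt] := partial_lt0_decreases
    (smooth_differentiable Cm (VA _ Vp)) dm (w0 _ (VA _ Vp)).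
  have [x Vx xp] := Vp.
  have [s s0 sx] : exists2 s, 0 <= s &
      gauge Omega (x + s *: coord_vec ord0) = gauge Omega x - t *: coord_vec ord0.
    by apply: gauge_time_translation; rewrite ?ltW ?xp//; apply: Om0; case: Vx.
  pose q := p - t *: coord_vec ord0.
  (* [q] comes from the same spatial point at the later time [x^0 + s]; either form of [I] is stable
     under adding [s >= 0]. *)
  have Vq : Vhat q.
    exists (x + s *: coord_vec ord0); last by rewrite sx xp.
    case: Vx => Ix Dx; split; last first.
      congr (D _): Dx; by apply/rowP => i; rewrite !mxE /= mulr0 addr0.
    rewrite !mxE/= mulr1; case: hI Ix => ->; rewrite /= !in_itv/= !andbT.
      by move=> x0; rewrite addr_ge0.
    by move=> x0; rewrite ltr_wpDr.
  have mq : 0 < m q by rewrite -mp.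
  (* The two levels are read off at [q]. *)
  exists (omega0 q + m q), (m q); split => //; last by exists q.
  by rewrite addr_gt0// /omega0 w0//; exact: VA.
move=> mu nu mu0 nu0; split.
  exact: (surface_H_submanifold oA hC uh sh w0 w1).
move=> y Hy; have [Vy wmy my] := Hy; have Ay := VA _ Vy.
have my0 : 0 < m y by rewrite /m my.
have gm0 := tmV _ Vy (ltW my0).
(* Tangent vectors are orthogonal to the timelike [grad h m], hence spacelike; the second goal
   concerns the null mean curvatures. *)
split=> [v vT v0|E ET].
  have [_ gmv] := tangent_H_orthogonal oA hC uh sh w0 w1 Ay vT.
  exact: (pullback_spacelike n0 pg cs Ay gm0 gmv v0).
have [trV trU] := tr mu nu y E mu0 nu0 Hy ET.
exact: (trapped oA hC uh sh w0 w1 Ay my0 gm0 (ns _ _ _ mu0 nu0 Hy) ET trU).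
Qed.
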